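(* Let $n,m\ge 1$, and consider the $m$-row shapes $\lambda=(n,\dots,n)$ (with $m$ rows of length $n$) and $\widetilde{\lambda}=(n+1,n,\dots,n,n-1)$ (first row of length $n+1$, last row of length $n-1$, all other rows of length $n$). Then $|S_1(\lambda)|=|S_0(\widetilde{\lambda})|$.
   Context: For a shape $\mu=(\mu_1,\dots,\mu_k)$ (non-increasing, rows of length zero omitted) with $N=\sum\mu_i$ boxes, a tableau of shape $\mu$ is a bijective filling of the left-justified Young diagram with $1,\dots,N$; it is row-standard if entries increase left to right along each row. For a row-standard tableau $\tau$, a pair of entries $i<j$ in the same column is an inversion if either (1) $i$ or $j$ has no entry immediately to its right and $i$ lies below $j$, or (2) $i$ is immediately followed on its right by $i'$, $j$ is immediately followed on its right by $j'$, and $i'>j'$. $S_i(\mu)$ is the set of row-standard tableaux of shape $\mu$ with exactly $i$ inversions; in particular $S_0(\mu)$ is the set of standard Young tableaux of shape $\mu$.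
   Formalization: For m = 1 the shape λ̃ does not exist (its single row would have to have both length n+1 and length n−1), so the theorem says nothing there; it is proved for all m ≥ 2 and n ≥ 1. *)

(* Defs.v *)
From mathcomp Require Import all_boot.

Set Implicit Arguments.
Unset Strict Implicit.
Unset Printing Implicit Defensive.

(* A shape is the sequence of its row lengths, from top to bottom. *)
Definition box (mu : seq nat) : finType :=
  {i : 'I_(size mu) & 'I_(nth 0 mu i)}.

Definition row (mu : seq nat) (b : box mu) : nat := tag b.
Definition col (mu : seq nat) (b : box mu) : nat := tagged b.

(* Entries are 0, ..., N-1 instead of 1, ..., N; only their relative order
   is ever used. *)
Definition filling (mu : seq nat) : finType :=
  {ffun box mu -> 'I_(sumn mu)}.

Definition is_tableau (mu : seq nat) (t : filling mu) : bool :=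
  injectiveb t && [forall k, k \in codom t].

Definition row_standard (mu : seq nat) (t : filling mu) : bool :=
  [forall b, forall c, (row b == row c) && (col b < col c) ==> (t b < t c)].

(* [right_of b b'] : b' is the box immediately to the right of b. *)
Definition right_of (mu : seq nat) (b b' : box mu) : bool :=
  (row b' == row b) && (col b' == (col b).+1).

Definition has_right (mu : seq nat) (b : box mu) : bool :=
  [exists b', right_of b b'].

(* With b and c the boxes holding the entries i < j of the same column. Rows
   are numbered downwards, so [row c < row b] says that i lies below j. *)
Definition inversion (mu : seq nat) (t : filling mu) (b c : box mu) : bool :=
  [&& col b == col c, t b < t c &
      (~~ has_right b || ~~ has_right c) && (row c < row b)
      || [exists b', exists c',
            [&& right_of b b', right_of c c' & t c' < t b']]].

Definition ninv (mu : seq nat) (t : filling mu) : nat :=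
  #|[set p : box mu * box mu | inversion t p.1 p.2]|.

Definition S_ (i : nat) (mu : seq nat) : {set filling mu} :=
  [set t | [&& is_tableau t, row_standard t & ninv t == i]].

Definition omit_zero_rows (mu : seq nat) : seq nat := [seq r <- mu | 0 < r].

(* The m row lengths (n+1, n, ..., n, n-1). For m = 1 the first row is also
   the last one, and no sequence satisfies the description. *)
Definition is_lambda_tilde (n m : nat) (mu : seq nat) : Prop :=
  [/\ size mu = m,
      nth 0 mu 0 = n.+1,
      nth 0 mu m.-1 = n.-1
    & forall i, 0 < i < m.-1 -> nth 0 mu i = n].

(* Main.v *)
Require Import Defs.
From mathcomp Require Import all_boot.
From mathcomp Require Import ssralg ssrnum ssrint zify.

Set Implicit Arguments.
Unset Strict Implicit.
Unset Printing Implicit Defensive.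

(** A row-standard tableau is the same thing as the word listing, for each
    entry in turn, the row that contains it; standard tableaux correspond to
    ballot words. Comparing consecutive columns from right to left, a tableau
    has exactly one inversion iff it is standard except that two adjacent rows
    [k], [k+1] are exchanged in the columns up to some [c]. In the word, this
    means that the walk of contents stays in the dominant chamber after some
    time and in its image under the [k]-th simple reflection before it.

    Removing the last letter gives a recursion for the number of such words of
    dominant content [x], and induction shows that it equals
    [sum_(i < j) f (x + e_i - e_j)], where [f y] counts the ballot words of
    content [y] and vanishes for [y] not dominant. For [x = (n, ..., n)] the
    only dominant term is [i] = first row, [j] = last row. *)

(** * Words, contents and dominance *)

Definition content (w : seq nat) (i : nat) : int := (count_mem i w)%:Z.

Definition add_box (x : nat -> int) (a i : nat) : int := (x i + (i == a)%:Z)%R.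
(** Integer values: removing a box from an empty row gives -1, the content of no word, where
    truncated subtraction would leave the row as it was. *)
Definition del_box (x : nat -> int) (a i : nat) : int := (x i - (i == a)%:Z)%R.

Definition dom (m : nat) (x : nat -> int) : bool :=
  all (fun i => (x i.+1 <= x i)%R) (iota 0 m.-1).

Definition eq_upto (m : nat) (x y : nat -> int) : bool :=
  all (fun i => x i == y i) (iota 0 m).

(* Words are stored in reverse: the head is the last letter, so that the tails
   are the prefixes of the word read in time order. *)
Fixpoint words (m N : nat) : seq (seq nat) :=
  if N is N'.+1 then [seq a :: w | a <- iota 0 m, w <- words m N'] else [:: [::]].

Fixpoint ballot (m : nat) (w : seq nat) : bool :=
  if w is _ :: w' then dom m (content w) && ballot m w' else true.

Definition swap_letter (k i : nat) : nat :=
  if i == k then k.+1 else if i == k.+1 then k else i.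

(* The letter [a] that makes the content dominant for good is the row at which
   dominance failed just before; exchanging [a] and [a.+1] in the earlier
   letters must give a ballot word. *)
Fixpoint once_crossing (m : nat) (w : seq nat) : bool :=
  if w is a :: w' then
    if dom m (content w') then once_crossing m w'
    else ballot m (map (swap_letter a) w')
  else false.

Definition nballot (m N : nat) (x : nat -> int) : nat :=
  count (fun w => ballot m w && eq_upto m (content w) x) (words m N).

Definition ncrossing (m N : nat) (x : nat -> int) : nat :=
  count (fun w => once_crossing m w && eq_upto m (content w) x) (words m N).

Lemma domP m x :
  reflect (forall i, i.+1 < m -> (x i.+1 <= x i)%R) (dom m x).
Proof.
apply: (iffP allP) => H i Hi; apply: H; move: Hi; rewrite mem_iota; lia.
Qed.

Lemma dom_leq m x a b : dom m x -> a <= b -> b < m -> (x b <= x a)%R.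
Proof.
move=> /domP H; elim: b => [|b IH] Hab Hb; first by have -> : a = 0 by lia.
case: (ltngtP a b.+1) Hab => // [Hlt _|-> //].
have := H b Hb; have := IH; lia.
Qed.

Lemma eq_uptoP m x y :
  reflect (forall i, i < m -> x i = y i) (eq_upto m x y).
Proof.
apply: (iffP allP) => H i Hi; first by apply/eqP/H; rewrite mem_iota.
by apply/eqP/H; move: Hi; rewrite mem_iota.
Qed.

Lemma eq_dom m x y : (forall i, i < m -> x i = y i) -> dom m x = dom m y.
Proof.
by move=> E; apply/domP/domP => H i Hi; have := H i Hi; rewrite !E //; lia.
Qed.

Lemma eq_eq_upto m x y z :
  (forall i, i < m -> x i = y i) -> eq_upto m z x = eq_upto m z y.
Proof. by move=> E; apply/eq_uptoP/eq_uptoP => H i Hi; rewrite H // E. Qed.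

Lemma eq_nballot m N x y :
  (forall i, i < m -> x i = y i) -> nballot m N x = nballot m N y.
Proof. by move=> E; apply: eq_count => w /=; rewrite (eq_eq_upto _ E). Qed.

Lemma ballot_dom m w : ballot m w -> dom m (content w).
Proof. by case: w => [_|a w /andP[]//]; apply/domP. Qed.

Lemma nballot_ndom m N x : ~~ dom m x -> nballot m N x = 0.
Proof.
move=> ndx; rewrite /nballot -[RHS](count_pred0 (words m N)).
apply: eq_count => w /=.
apply/negP => /andP[/ballot_dom dw /eq_uptoP E].
by move: ndx; rewrite -(eq_dom E) dw.
Qed.

(** * Recursions on the last letter *)

Lemma count_wordsS m N (P : pred (seq nat)) :
  count P (words m N.+1) =
  \sum_(a < m) count (fun w => P (val a :: w)) (words m N).
Proof.
rewrite /= count_flatten -map_comp sumnE big_map -[X in iota 0 X]subn0.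
rewrite big_mkord; apply: eq_bigr => a _ /=.
by rewrite count_map.
Qed.

Lemma eq_upto_cons m a w x :
  eq_upto m (content (a :: w)) x = eq_upto m (content w) (del_box x a).
Proof.
apply/eq_uptoP/eq_uptoP => H i Hi; have := H i Hi; rewrite /content /del_box /=;
  lia.
Qed.

Lemma nballotS m N x :
  nballot m N.+1 x = dom m x * \sum_(a < m) nballot m N (del_box x a).
Proof.
rewrite /nballot count_wordsS big_distrr /=; apply: eq_bigr => a _.
case: (boolP (dom m x)) => dx; rewrite ?mul1n ?mul0n.
  apply: eq_count => w; rewrite -eq_upto_cons -[in LHS]andbA.
  case: (boolP (eq_upto _ _ _)) => [/eq_uptoP E|]; last by rewrite !andbF.
  by rewrite (eq_dom E) dx.
rewrite -(count_pred0 (words m N)); apply: eq_count => w /=.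
apply/negP => /andP[/andP[dw _] /eq_uptoP E].
by move: dx; rewrite -(eq_dom E) dw.
Qed.

Lemma mem_words m N w : (w \in words m N) = (size w == N) && all (gtn m) w.
Proof.
elim: N w => [|N IH] w; first by rewrite inE; case: w.
apply/allpairsP/idP => [[[a v] /= [Ha Hv ->]]|].
  by move: Ha Hv; rewrite mem_iota IH /= eqSS => -> /andP[-> ->].
case: w => // a w /=; rewrite eqSS => /and3P[sw am aw].
by exists (a, w); rewrite mem_iota IH sw aw.
Qed.

Lemma uniq_words m N : uniq (words m N).
Proof.
elim: N => //= N IH; apply: allpairs_uniq => //; first exact: iota_uniq.
by move=> [a v] [b w] _ _ /= [-> ->].
Qed.

Lemma swap_letterL k : swap_letter k k = k.+1.
Proof. by rewrite /swap_letter eqxx. Qed.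

Lemma swap_letterR k : swap_letter k k.+1 = k.
Proof. by rewrite /swap_letter gtn_eqF // eqxx. Qed.

Lemma swap_letterK k : involutive (swap_letter k).
Proof.
move=> i; rewrite /swap_letter; case: (eqVneq i k) => [->|Hik].
  by rewrite eqxx gtn_eqF.
by case: (eqVneq i k.+1) => [->|/negbTE->]; rewrite ?eqxx // (negbTE Hik).
Qed.

Lemma swap_letter_ltn m k i : k.+1 < m -> i < m -> swap_letter k i < m.
Proof. by move=> km im; rewrite /swap_letter; do 2?[case: eqP => // _]; lia. Qed.

Lemma perm_swap_words m N k :
  k.+1 < m -> perm_eq (words m N) (map (map (swap_letter k)) (words m N)).
Proof.
move=> Hk; have K : involutive (map (swap_letter k)).
  exact: mapK (swap_letterK k).
apply: uniq_perm; rewrite ?(map_inj_uniq (inv_inj K)) ?uniq_words //.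
have sub w : w \in words m N -> map (swap_letter k) w \in words m N.
  rewrite !mem_words size_map all_map => /andP[-> /allP H] /=.
  by apply/allP => i /H /=; exact: swap_letter_ltn.
move=> w; apply/idP/mapP => [Hw|[v Hv ->]]; last exact: sub.
by exists (map (swap_letter k) w); rewrite ?K ?sub.
Qed.

Lemma content_swap k w i :
  content (map (swap_letter k) w) i = content w (swap_letter k i).
Proof.
rewrite /content count_map; congr (Posz _); apply: eq_count => j /=.
by rewrite (inv_eq (swap_letterK k)).
Qed.

(** Only the comparison of rows [a] and [a.+1] can break. The last row can always be shortened,
    since [dom] does not ask for nonnegative values. *)
Lemma dom_del m x a :
  dom m x -> a < m -> dom m (del_box x a) = (a.+1 == m) || (x a.+1 < x a)%R.
Proof.
move=> /domP dx am; apply/domP/idP => [H|H i Hi].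
  case: (eqVneq a.+1 m) => //= Hm; have := H a; rewrite /del_box; lia.
have := dx i Hi; rewrite /del_box.
case: (eqVneq i a) => [E|]; [subst i|]; lia.
Qed.

Lemma del_box_swap x a i :
  x a = x a.+1 -> del_box x a (swap_letter a i) = del_box x a.+1 i.
Proof.
rewrite /del_box /swap_letter => E; case: (eqVneq i a) => [->|Hia].
  by rewrite E; lia.
case: (eqVneq i a.+1) => [->|_]; last lia.
by rewrite E; lia.
Qed.

(** Split by the last letter [a]. If dominance fails just before it, then [x a = x a.+1], and
    exchanging the letters [a] and [a.+1] turns the rest into a ballot word whose content is [x]
    less a box in row [a.+1]. *)
Lemma ncrossingS m N x : dom m x ->
  ncrossing m N.+1 x =
  \sum_(a < m) (dom m (del_box x a) * ncrossing m N (del_box x a)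
    + ~~ dom m (del_box x a) * nballot m N (del_box x a.+1)).
Proof.
move=> dx; rewrite /ncrossing count_wordsS; apply: eq_bigr => a _ /=.
case: (boolP (dom m (del_box x a))) => da; rewrite mul1n mul0n ?addn0 ?add0n.
  apply: eq_count => w; rewrite -/(eq_upto _ _ _) eq_upto_cons.
  case: (boolP (eq_upto _ _ _)) => [/eq_uptoP E|]; last by rewrite !andbF.
  by rewrite (eq_dom E) da.
have := da; rewrite dom_del // => da'.
have Hx : x a = x a.+1.
  have := dx => /domP /(_ a) ; have := ltn_ord a; lia.
rewrite /nballot [RHS](permP (perm_swap_words N (k := a) _)); last first.
  have := ltn_ord a; lia.
rewrite count_map; apply: eq_count => w /=; rewrite eq_upto_cons.
have -> : eq_upto m (content (map (swap_letter a) w)) (del_box x a.+1)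
        = eq_upto m (content w) (del_box x a).
  have am : a.+1 < m by have := ltn_ord a; lia.
  apply/eq_uptoP/eq_uptoP => H i Hi.
    have := H _ (swap_letter_ltn am Hi).
    by rewrite content_swap swap_letterK -del_box_swap // swap_letterK.
  rewrite content_swap H ?del_box_swap //; exact: swap_letter_ltn.
case: (boolP (eq_upto _ _ _)) => [/eq_uptoP E|]; last by rewrite !andbF.
by rewrite (eq_dom E) (negbTE da).
Qed.

(** * Raised contents and the counting identity *)

Definition nraised (m N : nat) (x : nat -> int) : nat :=
  \sum_(i < m) \sum_(j < m | i < j) nballot m N (del_box (add_box x i) j).

Lemma ncrossing0 m x : ncrossing m 0 x = 0.
Proof. by []. Qed.

(** The empty word would require [x i = -1] and [x j = 1] with [i < j], against dominance. *)
Lemma nraised0 m x : dom m x -> nraised m 0 x = 0.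
Proof.
move=> dx; apply: big1 => i _; apply: big1 => j ij.
rewrite /nballot /= addn0; apply/eqP; rewrite eqb0; apply/negP => /eq_uptoP H.
have := dom_leq dx (ltnW ij) (ltn_ord j).
have := H i (ltn_ord i); have := H j (ltn_ord j).
rewrite /content /del_box /add_box /= !eqxx; lia.
Qed.

(** As [i < j], the only comparisons that tighten are row [i] with the row above it and row [j] with
    the row below it. *)
Lemma dom_raise m x i j : dom m x -> i < j -> j < m ->
  dom m (del_box (add_box x i) j)
    = ((i == 0) || (x i < x i.-1)%R) && dom m (del_box x j).
Proof.
move=> dx ij jm; rewrite (dom_del dx jm); have /domP dx' := dx.
apply/domP/andP => [H|[H1 H2] p Hp].
  split.
    case: i ij H => //= i ij H; have := H i; rewrite /del_box /add_box; lia.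
  have := H j; rewrite /del_box /add_box; lia.
have := dx' p Hp; rewrite /del_box /add_box.
case: (eqVneq p j) => [E|pj]; first by subst p; lia.
case: (eqVneq p.+1 i) => [E|pi]; last lia.
by subst i; move: H1 => /=; lia.
Qed.

Lemma ltn_dom_del m x i : dom m x -> i.+1 < m ->
  dom m (del_box x i) = (x i.+1 < x i)%R.
Proof. by move=> dx im; rewrite dom_del //; lia. Qed.

Lemma nraisedS m N x :
  nraised m N.+1 x =
  \sum_(i < m) \sum_(j < m | i < j) \sum_(l < m)
    dom m (del_box (add_box x i) j)
      * nballot m N (del_box (del_box (add_box x i) j) l).
Proof.
apply: eq_bigr => i _; apply: eq_bigr => j ij.
by rewrite nballotS big_distrr.
Qed.

(** Same triple sum as in [nraisedS], with another dominance factor; the induction compares the two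
    term by term. *)
Lemma sum_nraised_del m N x :
  \sum_(l < m) dom m (del_box x l) * nraised m N (del_box x l) =
  \sum_(i < m) \sum_(j < m | i < j) \sum_(l < m)
    dom m (del_box x l) * nballot m N (del_box (del_box (add_box x i) j) l).
Proof.
transitivity (\sum_(l < m) \sum_(i < m) \sum_(j < m | i < j)
    dom m (del_box x l) * nballot m N (del_box (del_box (add_box x i) j) l)).
  apply: eq_bigr => l _; rewrite big_distrr; apply: eq_bigr => i _ /=.
  rewrite big_distrr; apply: eq_bigr => j _ /=; congr (_ * _).
  by apply: eq_nballot => p _; rewrite /del_box /add_box; lia.
rewrite exchange_big; apply: eq_bigr => i _ /=.
by rewrite exchange_big.
Qed.

(** If the ballot count is nonzero, its content is dominant, and this forces both dominance factors
    to be true. *)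
Lemma raise_below m N x (i j l : nat) : dom m x -> l < i -> i < j -> j < m ->
  dom m (del_box (add_box x i) j)
    * nballot m N (del_box (del_box (add_box x i) j) l)
  = dom m (del_box x l) * nballot m N (del_box (del_box (add_box x i) j) l).
Proof.
move=> dx li ij jm.
case: (boolP (dom m (del_box (del_box (add_box x i) j) l))) => [/domP H|nd];
  last by rewrite !(nballot_ndom _ nd) !muln0.
have /domP dx' := dx.
rewrite dom_raise // !dom_del //; last by lia.
have -> : (l.+1 == m) || (x l.+1 < x l)%R.
  have := H l; rewrite /del_box /add_box; lia.
have -> : (j.+1 == m) || (x j.+1 < x j)%R.
  have := H j; rewrite /del_box /add_box; lia.
suff -> : (i == 0) || (x i < x i.-1)%R by [].
case: i li ij H => //= i li ij H.
have := H i; have := dx' i; rewrite /del_box /add_box; lia.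
Qed.

(** A nonzero ballot count forces row [i] to be extendable, so only the condition at row [j] is
    left. Exchanging [j] and [l], both below row [i], later turns it into the condition at row
    [l]. *)
Lemma raise_above m N x (i j l : nat) : dom m x -> i < l -> i < j -> j < m ->
  dom m (del_box (add_box x i) j)
    * nballot m N (del_box (del_box (add_box x i) j) l)
  = dom m (del_box x j) * nballot m N (del_box (del_box (add_box x i) j) l).
Proof.
move=> dx li ij jm.
case: (boolP (dom m (del_box (del_box (add_box x i) j) l))) => [/domP H|nd];
  last by rewrite !(nballot_ndom _ nd) !muln0.
rewrite dom_raise //.
suff -> : (i == 0) || (x i < x i.-1)%R by [].
case: i li ij H => //= i li ij H.
have := H i; rewrite /del_box /add_box; lia.
Qed.

(* For removable [j], the left side counts the constant runs of [x] starting
   above row [j] and the first sum on the right those ending there; they differ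
   by the run containing [j], if it starts above [j]. *)
Lemma sum_raise_diag m N x : dom m x ->
  \sum_(i < m) \sum_(j < m | i < j)
     dom m (del_box (add_box x i) j) * nballot m N (del_box x j)
  = \sum_(i < m) \sum_(j < m | i < j)
      dom m (del_box x i) * nballot m N (del_box x j)
    + \sum_(a < m) ~~ dom m (del_box x a) * nballot m N (del_box x a.+1).
Proof.
move=> dx.
(* Reindexing by [j = a.+1]: the last row [a] contributes nothing, being always removable, and
   [0 < j] excludes the new index 0. *)
have -> : \sum_(a < m) ~~ dom m (del_box x a) * nballot m N (del_box x a.+1)
  = \sum_(j < m) ((0 < j) && ~~ dom m (del_box x j.-1))
      * nballot m N (del_box x j).
  case: m dx => [|m] dx; first by rewrite !big_ord0.
  rewrite big_ord_recr big_ord_recl /= dom_del // eqxx /= !addn0 add0n.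
  by apply: eq_bigr => j _.
rewrite (exchange_big_dep xpredT) //= [in RHS](exchange_big_dep xpredT) //=.
rewrite -big_split; apply: eq_bigr => j _ /=.
rewrite -!big_distrl /= -mulnDl.
case: (boolP (dom m (del_box x j))) => dj; last by rewrite !nballot_ndom ?muln0.
congr (_ * _).
have W F : \sum_(i < m | i < j) F (val i) = \sum_(0 <= i < j) F i.
  rewrite big_mkord (big_ord_widen m F) //; exact: ltnW.
rewrite (W (fun i => nat_of_bool (dom m (del_box (add_box x i) j)))).
rewrite (W (fun i => nat_of_bool (dom m (del_box x i)))).
case: j dj {W} => -[|j] jm /= dj; first by rewrite !big_geq.
(* Row 0 can always be extended, and row [i.+1] can be extended iff row [i] can be shortened. So the
   sums agree after a shift, and the extra 1 is a truth value plus its negation. *)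
rewrite big_nat_recl // big_nat_recr //= dom_raise // dj /= addnC -addnA.
congr (_ + _); last by case: (dom _ _).
apply: eq_big_nat => i /andP[_ ij].
by rewrite dom_raise // dj andbT ltn_dom_del //; lia.
Qed.

Lemma sum_ord_split m (i : 'I_m) (F : nat -> nat) :
  \sum_(l < m) F l
  = \sum_(l < m | l < i) F l + F i + \sum_(l < m | i < l) F l.
Proof.
rewrite (bigID (fun l : 'I_m => l < i)) /= -addnA; congr (_ + _).
rewrite (bigD1 i) /= ?ltnn //; congr (_ + _).
by apply: eq_bigl => l; rewrite -leqNgt -(inj_eq val_inj) /=; lia.
Qed.

(** Induction on the length, splitting the triple sums by the position of the removed row [l]
    relative to the raised row [i]. The parts [l < i] and [l > i] agree; the parts [l = i] differ
    exactly by the reflected terms of [ncrossingS]. *)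
Lemma ncrossing_nraised m N x : dom m x -> ncrossing m N x = nraised m N x.
Proof.
elim: N x => [|N IH] x dx; first by rewrite ncrossing0 nraised0.
rewrite ncrossingS // big_split /=.
under eq_bigr => l _.
  have -> : dom m (del_box x l) * ncrossing m N (del_box x l)
          = dom m (del_box x l) * nraised m N (del_box x l).
    by case: (boolP (dom _ _)) => // /IH ->.
  over.
rewrite sum_nraised_del nraisedS.
have split3 (D : nat -> nat -> nat -> nat) :
  \sum_(i < m) \sum_(j < m | i < j) \sum_(l < m) D i j l
  = \sum_(i < m) \sum_(j < m | i < j) \sum_(l < m | l < i) D i j l
  + \sum_(i < m) \sum_(j < m | i < j) D i j i
  + \sum_(i < m) \sum_(j < m | i < j) \sum_(l < m | i < l) D i j l.
  rewrite -!big_split; apply: eq_bigr => i _ /=.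
  rewrite -!big_split; apply: eq_bigr => j _ /=; exact: sum_ord_split.
rewrite (split3 (fun i j l => dom m (del_box (add_box x i) j)
    * nballot m N (del_box (del_box (add_box x i) j) l))).
rewrite (split3 (fun i j l => dom m (del_box x l)
    * nballot m N (del_box (del_box (add_box x i) j) l))).
have diag (D : nat -> nat -> nat) :
  \sum_(i < m) \sum_(j < m | i < j)
    D i j * nballot m N (del_box (del_box (add_box x i) j) i)
  = \sum_(i < m) \sum_(j < m | i < j) D i j * nballot m N (del_box x j).
  apply: eq_bigr => i _; apply: eq_bigr => j _; congr (_ * _).
  by apply: eq_nballot => p _; rewrite /del_box /add_box; lia.
have -> : \sum_(i < m) \sum_(j < m | i < j) \sum_(l < m | i < l)
    dom m (del_box (add_box x i) j)
      * nballot m N (del_box (del_box (add_box x i) j) l)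
  = \sum_(i < m) \sum_(j < m | i < j) \sum_(l < m | i < l)
    dom m (del_box x l) * nballot m N (del_box (del_box (add_box x i) j) l).
  apply: eq_bigr => i _; rewrite [RHS]exchange_big /=.
  apply: eq_bigr => j ij; apply: eq_bigr => l il.
  rewrite raise_above //; congr (_ * _).
  by apply: eq_nballot => p _; rewrite /del_box /add_box; lia.
have -> : \sum_(i < m) \sum_(j < m | i < j) \sum_(l < m | l < i)
    dom m (del_box (add_box x i) j)
      * nballot m N (del_box (del_box (add_box x i) j) l)
  = \sum_(i < m) \sum_(j < m | i < j) \sum_(l < m | l < i)
    dom m (del_box x l) * nballot m N (del_box (del_box (add_box x i) j) l).
  apply: eq_bigr => i _; apply: eq_bigr => j ij; apply: eq_bigr => l il.
  exact: raise_below.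
rewrite (diag (fun i j => nat_of_bool (dom m (del_box (add_box x i) j)))).
rewrite (diag (fun i j => nat_of_bool (dom m (del_box x i)))).
by rewrite sum_raise_diag // !addnA [LHS]addnAC.
Qed.

Lemma nraised_rectangle m N (n : int) :
  nraised m.+2 N (fun=> n)
  = nballot m.+2 N (del_box (add_box (fun=> n) 0) m.+1).
Proof.
have z (i j : 'I_m.+2) : i < j -> (val i != 0) || (val j != m.+1) ->
    nballot m.+2 N (del_box (add_box (fun=> n) i) j) = 0.
  move=> ij H; apply: nballot_ndom; have jm := ltn_ord j.
  have dn : dom m.+2 (fun=> n) by apply/domP.
  by rewrite dom_raise // dom_del //; move: H => /=; lia.
rewrite /nraised (bigD1 ord0) //= [X in _ + X]big1 ?addn0; last first.
  move=> i i0; apply: big1 => j ij; apply: z => //.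
  by rewrite -(inj_eq val_inj) in i0; rewrite i0.
rewrite (bigD1 ord_max) //= big1 ?addn0 // => j /andP[j0 jm].
by apply: (z ord0 j) => //; rewrite -(inj_eq val_inj) in jm; rewrite jm orbT.
Qed.

(** * Prefixes and the crossing time *)

Lemma leq_of_ltn p q : (forall j, j < p -> j < q) -> p <= q.
Proof. by case: p => // p; apply. Qed.

(** A downward closed [P] holds exactly on an initial segment, whose length is the count. *)
Lemma ltn_count_initial (P : pred nat) n j :
    (forall a b, a < b -> b < n -> P b -> P a) ->
  (j < count P (iota 0 n)) = (j < n) && P j.
Proof.
elim: n => [|n IH] H; first by rewrite /= ltn0.
rewrite -[n.+1]addn1 iotaD count_cat /= add0n addn0.
have {}IH := IH (fun a b ab bn => H a b ab (ltnW bn)).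
case: (boolP (P n)) => Pn.
  have /eqP -> : count P (iota 0 n) == n.
    rewrite -{2}(size_iota 0 n) -all_count; apply/allP => i.
    by rewrite mem_iota => Hi; apply: (H i n).
  rewrite addn1 ltnS; case: (leqP j n) => //=.
  by rewrite leq_eqVlt => /predU1P[->//|jn]; rewrite (H j n).
rewrite addn0 IH; case: (eqVneq j n) => [->|jn].
  by rewrite (negbTE Pn) !andbF.
congr (_ && _); lia.
Qed.

(* The first [q] letters of [r 0, r 1, ...], latest first. *)
Fixpoint prefix_word (r : nat -> nat) (q : nat) : seq nat :=
  if q is q'.+1 then r q' :: prefix_word r q' else [::].

Lemma ballot_prefix_wordP m r q :
  reflect (forall p, p <= q -> dom m (content (prefix_word r p)))
          (ballot m (prefix_word r q)).
Proof.
elim: q => [|q IH]; first by constructor=> -[|] // _; apply/domP.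
apply: (iffP andP) => [[H1 /IH H2] p|H]; first by case: ltngtP => // [/H2|->].
by split; [exact: (H q.+1) | apply/IH => p pq; apply: H; lia].
Qed.

Lemma map_prefix_word s r q :
  map s (prefix_word r q) = prefix_word (s \o r) q.
Proof. by elim: q => //= q ->. Qed.

(** The recursion stops at [p], the last time before [q] at which dominance fails. The whole word is
    not tested, hence the strict bound on [p']. *)
Lemma once_crossing_prefix_wordP m r q :
  reflect (exists p, [/\ p < q,
             forall p', p < p' < q -> dom m (content (prefix_word r p')),
             ~~ dom m (content (prefix_word r p))
           & ballot m (map (swap_letter (r p)) (prefix_word r p))])
          (once_crossing m (prefix_word r q)).
Proof.
elim: q => [|q IH] /=; first by constructor=> -[p []].
case: ifPn => dq.
  apply: (iffP IH) => -[p [pq H1 H2 H3]]; exists p; split=> //.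
  - lia.
  - move=> p' Hp'; case: (eqVneq p' q) => [->//|] ?; apply: H1; lia.
  - by case: (eqVneq p q) => [E|]; [rewrite E dq in H2 | lia].
  - by move=> p' Hp'; apply: H1; lia.
apply: (iffP idP) => [H|[p [pq H1 H2 H3]]].
  by exists q; split=> // p'; lia.
case: (eqVneq p q) => [<-//|pq']; case/negP: dq; apply: H1; lia.
Qed.

(** * Standardness and crossings read on the word *)

Section Tableau.

(** A row-standard tableau without dependent box types: [T i j] is the entry in row [i] and column
    [j], and [r k] is the row of the entry [k]. *)
Variables (mu : seq nat) (T : nat -> nat -> nat) (r : nat -> nat).
Local Notation M i := (nth 0 mu i).
Local Notation N := (sumn mu).

Hypothesis part_mu : forall a b, a <= b -> M b <= M a.
Hypothesis T_mono : forall i j j', j < j' -> j' < M i -> T i j < T i j'.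
Hypothesis T_bound : forall i j, j < M i -> T i j < N.
Hypothesis rT : forall i j, j < M i -> r (T i j) = i.
Hypothesis Tr : forall k, k < N -> exists2 j, j < M (r k) & T (r k) j = k.

Definition standard :=
  forall a b j, a < b -> j < M b -> T a j < T b j.

(* Row [k] and row [k.+1] are exchanged in the columns up to [c], and this is
   the only defect of standardness. *)
Definition crossed (k c : nat) :=
  c < M k.+1 /\ forall a b j, a < b -> j < M b ->
    (T b j < T a j) = [&& a == k, b == k.+1 & j <= c].

Definition violated (a b j : nat) := (j < M b) && (T b j < T a j).
(** As nothing is violated past the end of the lower row, this single condition covers both clauses
    in the definition of an inversion in column [j]. *)
Definition flipped (a b j : nat) := violated a b j != violated a b j.+1.

Lemma row_ltn m i j : size mu <= m -> j < M i -> i < m.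
Proof.
move=> sm H; case: (ltnP i (size mu)) => H'; first lia.
by rewrite nth_default in H.
Qed.

Lemma T_eq a b i j : i < M a -> j < M b -> T a i = T b j -> a = b.
Proof. by move=> Hi Hj E; rewrite -(rT Hi) E rT. Qed.

Lemma count_prefix_word q i : q <= N ->
  count_mem i (prefix_word r q) = count (fun j => T i j < q) (iota 0 (M i)).
Proof.
elim: q => [|q IH] qN; first by rewrite -[LHS](count_pred0 (iota 0 (M i))).
rewrite /= IH; last lia.
have [j0 Hj0 Tj0] := Tr qN.
have -> : count (fun j => T i j < q.+1) (iota 0 (M i))
  = count (fun j => T i j == q) (iota 0 (M i))
    + count (fun j => T i j < q) (iota 0 (M i)).
  rewrite -count_predUI [X in _ + X](_ : _ = 0) ?addn0.
    by apply: eq_count => j /=; rewrite ltnS leq_eqVlt.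
  by rewrite -[RHS](count_pred0 (iota 0 (M i))); apply: eq_count => j /=; lia.
congr (_ + _); case: (eqVneq (r q) i) => [E|ne].
  subst i; rewrite (_ : count _ _ = count_mem j0 (iota 0 (M (r q)))).
    by rewrite count_uniq_mem ?iota_uniq // mem_iota Hj0.
  apply: eq_in_count => j; rewrite mem_iota => Hj /=.
  apply/eqP/eqP => [E|->//]; case: (ltngtP j j0) => // lt.
    by have := T_mono lt Hj0; lia.
  by have := T_mono lt Hj; lia.
rewrite -[LHS](count_pred0 (iota 0 (M i))); apply: eq_in_count => j.
rewrite mem_iota => Hj /=; apply/esym/eqP => E; case/eqP: ne.
by rewrite -E rT.
Qed.

(** Dictionary between contents and entries: rows increase, so the boxes of a row filled before time
    [q] form an initial segment. *)
Lemma ltn_count_prefix_word q i j : q <= N ->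
  (j < count_mem i (prefix_word r q)) = (j < M i) && (T i j < q).
Proof.
move=> qN; rewrite count_prefix_word // ltn_count_initial //.
by move=> a b ab bM; have := T_mono ab bM; lia.
Qed.

Lemma dom_word m : dom m (content (prefix_word r N)).
Proof.
apply/domP => i im; apply: leq_of_ltn => j; rewrite !ltn_count_prefix_word //.
have := @part_mu i i.+1; have := @T_bound i j; lia.
Qed.

(** Dominance just after the entry [T b j] is read says that the higher row [a] already has its box
    in column [j]. *)
Lemma ballot_word_standard m : size mu <= m ->
  reflect standard (ballot m (prefix_word r N)).
Proof.
move=> sm; apply: (iffP (ballot_prefix_wordP _ _ _)) => [H a b j ab jb|H p pN].
  have bm := row_ltn sm jb; have TN := T_bound jb.
  have := dom_leq (H _ TN) (ltnW ab) bm; rewrite /content.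
  have := ltn_count_prefix_word b j TN; have := ltn_count_prefix_word a j TN.
  rewrite jb ltnS leqnn /= => Ha Hb Hab.
  have /andP[ja Tab] : (j < M a) && (T a j < (T b j).+1) by lia.
  have := @T_eq a b j j ja jb; lia.
apply/domP => i im; apply: leq_of_ltn => j; rewrite !ltn_count_prefix_word //.
have := H i i.+1 j; have := @part_mu i i.+1; lia.
Qed.

Lemma swap_letter_mono k a b :
  a < b -> (a != k) || (b != k.+1) -> swap_letter k a < swap_letter k b.
Proof.
rewrite /swap_letter => ab H.
case: (eqVneq a k) => [E|ak].
  subst a; case: (eqVneq b k) => [|bk]; first lia.
  case: (eqVneq b k.+1) => [|]; lia.
case: (eqVneq a k.+1) => [E|ak1].
  subst a; case: (eqVneq b k) => [|bk]; first lia.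
  case: (eqVneq b k.+1) => [|]; lia.
case: (eqVneq b k) => [|bk]; first lia.
case: (eqVneq b k.+1) => [|]; lia.
Qed.

(** Here [p] is the last time at which dominance fails, [k] the letter read then, and [c] the column
    which that letter fills. *)
Lemma once_crossing_crossed m : size mu <= m ->
  once_crossing m (prefix_word r N) -> exists k c, crossed k c.
Proof.
move=> sm /once_crossing_prefix_wordP[p [pN D1 D3 /[!map_prefix_word]]].
move=> /ballot_prefix_wordP; set k := r p => D2.
have {}D2 q : q <= p -> dom m (content (prefix_word r q) \o swap_letter k).
  move=> qp; rewrite -(eq_dom (fun i _ => content_swap k _ i)) map_prefix_word.
  exact: D2.
have {}D1 q : p < q -> q <= N -> dom m (content (prefix_word r q)).
  move=> pq; rewrite leq_eqVlt => /predU1P[->|qN]; first exact: dom_word.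
  by apply: D1; rewrite pq.
pose cnt i q := count_mem i (prefix_word r q).
have key i j q : q <= N -> (j < cnt i q) = (j < M i) && (T i j < q).
  exact: ltn_count_prefix_word.
(* A single letter restores dominance, so the failing row is [k] and its deficit is exactly one
   box. *)
have [km Ek] : k.+1 < m /\ cnt k.+1 p = (cnt k p).+1.
  move: D3; rewrite -has_predC => /hasP[i]; rewrite mem_iota /= => im.
  have := D1 p.+1 (ltnSn p) pN => /domP /(_ i); rewrite /content /= -/k.
  rewrite -/(cnt i p) -/(cnt i.+1 p) => H H'.
  have E : k = i by lia.
  rewrite E; lia.
have pNw := ltnW pN.
exists k, (cnt k p); split.
  by have := key k.+1 (cnt k p) p pNw; rewrite Ek ltnSn => /esym/andP[].
move=> a b j ab jb.
have TbN := T_bound jb.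
have ja : j < M a by have := part_mu (ltnW ab); lia.
have TaN := T_bound ja.
have ne : T a j != T b j by apply/eqP => /(T_eq ja jb); lia.
have bm := row_ltn sm jb.
have late : p <= T b j -> T a j < T b j.
  move=> pT; have := D1 (T b j).+1 pT TbN => /dom_leq /(_ (ltnW ab) bm).
  have := key a j (T b j).+1 TbN; have := key b j (T b j).+1 TbN.
  rewrite /cnt /content jb ja /=; lia.
case: (boolP ((a == k) && (b == k.+1))) => [/andP[/eqP Ea /eqP Eb]|nab].
  subst a b; rewrite !eqxx /=; have kb := key k.+1 j p pNw.
  have ka := key k j p pNw.
  rewrite jb Ek /= in kb; rewrite ja /= in ka.
  apply/idP/idP => H; first by case: (leqP p (T k.+1 j)) => [/late|]; lia.
  (* Were row [k] first in column [j], the reflected dominance just after [T k j] would put the box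
     of row [k.+1] earlier still. *)
  case: (ltngtP (T k.+1 j) (T k j)) => // [lt|/esym/eqP]; last by rewrite (negbTE ne).
  have qp : (T k j).+1 <= p by lia.
  have := D2 _ qp => /domP /(_ k km).
  rewrite /content /= swap_letterL swap_letterR.
  have := key k j (T k j).+1 TaN; have := key k.+1 j (T k j).+1 TaN.
  rewrite /cnt ja jb /=; lia.
have -> : [&& a == k, b == k.+1 & j <= cnt k p] = false.
  by rewrite andbA (negbTE nab).
case: (leqP p (T b j)) => [/late|lt]; first lia.
(* The reflection keeps the order of every other pair of rows, so before [p] such a pair compares as
   in a standard tableau. *)
have sab : swap_letter k a < swap_letter k b.
  by apply: swap_letter_mono => //; rewrite -negb_and.
have sbm : swap_letter k b < m by apply: swap_letter_ltn.
have := dom_leq (D2 _ lt) (ltnW sab) sbm.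
rewrite /content /= !swap_letterK.
have := key a j (T b j).+1 TbN; have := key b j (T b j).+1 TbN.
rewrite /cnt ja jb /=; lia.
Qed.

(** Dominance last fails at time [T k c], when row [k.+1] already has its box in column [c] and row
    [k] is about to receive it. *)
Lemma crossed_once_crossing m k c : size mu <= m ->
  crossed k c -> once_crossing m (prefix_word r N).
Proof.
move=> sm [cM X]; have ck : c < M k by have := @part_mu k k.+1; lia.
have km := row_ltn sm cM.
have pN := T_bound ck.
pose cnt i q := count_mem i (prefix_word r q).
have key i j q : q <= N -> (j < cnt i q) = (j < M i) && (T i j < q).
  exact: ltn_count_prefix_word.
have ne a b j : a < b -> j < M b -> T a j != T b j.
  move=> ab jb; apply/eqP; have := part_mu (ltnW ab) => ? /T_eq.
  by move=> /(_ ltac:(lia) jb); lia.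
have mono i j j' : j <= j' -> j' < M i -> T i j <= T i j'.
  by rewrite leq_eqVlt => /predU1P[->//|lt lt']; apply/ltnW/T_mono.
have good a b q : a < b -> q <= N -> (a != k) || (b != k.+1) ->
    cnt b q <= cnt a q.
  move=> ab qN H; apply: leq_of_ltn => j; rewrite !key // => /andP[jb lt].
  have := X a b j ab jb; have := ne a b j ab jb; have := part_mu (ltnW ab).
  move: H; rewrite -negb_and andbA => /negbTE->; lia.
apply/once_crossing_prefix_wordP; exists (T k c); split=> //.
- move=> q /andP[pq qN]; apply/domP => i im.
  case: (eqVneq i k) => [->|ik]; last first.
    by apply: good; rewrite ?ik //; apply: ltnW.
  (* Columns beyond [c] are in standard order, and up to [c] row [k] is already filled. *)
  apply: leq_of_ltn => j; rewrite !key ?(ltnW qN) // => /andP[jb lt].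
  have := X k k.+1 j (ltnSn k) jb; have := ne k k.+1 j (ltnSn k) jb.
  rewrite !eqxx /=; have := @part_mu k k.+1; have := mono k j c.
  by case: (leqP j c); lia.
- apply/negP => /domP /(_ k km) H.
  have := key k c (T k c) (ltnW pN); have := key k.+1 c (T k c) (ltnW pN).
  have := X k k.+1 c (ltnSn k) cM; rewrite !eqxx leqnn cM ck ltnn /= => ->.
  move: H; rewrite /content -/(cnt k _) -/(cnt k.+1 _); lia.
rewrite rT // map_prefix_word; apply/ballot_prefix_wordP => q qp.
have qN : q <= N by lia.
apply/domP => i im; rewrite -map_prefix_word !content_swap /content.
rewrite -/(cnt _ _) -/(cnt _ _); case: (eqVneq i k) => [->|ik].
  rewrite swap_letterL swap_letterR.
  apply: leq_of_ltn => j; rewrite !key // => /andP[jk lt].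
  (* Up to time [T k c], row [k] only has boxes in columns where row [k.+1] comes first. *)
  have jc : j <= c by case: (leqP j c) => // cj; have := T_mono cj jk; lia.
  have jM : j < M k.+1 by lia.
  have := X k k.+1 j (ltnSn k) jM; rewrite !eqxx jc /=; lia.
apply: good => //; first by apply: swap_letter_mono => //; rewrite ik.
rewrite -negb_and; apply/negP => /andP[/eqP si /eqP si1].
move: (congr1 (swap_letter k) si) (congr1 (swap_letter k) si1).
rewrite !swap_letterK swap_letterL swap_letterR; lia.
Qed.

Lemma violated_eventually a b j : M b <= j -> violated a b j = false.
Proof. by rewrite /violated; lia. Qed.

(** The status never changes from column [j] on, and past the end of row [b] it is false. *)
Lemma not_flipped_not_violated a b j :
  (forall j', j <= j' -> ~~ flipped a b j') -> violated a b j = false.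
Proof.
have [d] := ubnP (M b - j); elim: d j => // d IH j Hd H.
case: (leqP (M b) j) => [/violated_eventually//|jM].
have /eqP -> := negPn (H j (leqnn j)).
by apply: IH => [|j' jj']; [lia | apply: H; lia].
Qed.

Lemma standard_not_flipped :
  standard <-> forall a b j, a < b -> ~~ flipped a b j.
Proof.
split=> [H a b j ab|H a b j ab jb].
  have z j' : violated a b j' = false.
    by rewrite /violated; case: ltnP => //= /(H _ _ _ ab); lia.
  by rewrite /flipped !z.
have := @not_flipped_not_violated a b j (fun j' _ => H a b j' ab).
rewrite /violated jb /=; have := part_mu (ltnW ab) => Mab.
have := @T_eq a b j j; lia.
Qed.

Lemma crossed_flipped k c : crossed k c ->
  forall a b j, a < b ->
    flipped a b j = [&& a == k, b == k.+1 & j == c].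
Proof.
move=> [cM X] a b j ab.
have V j' : violated a b j' = [&& a == k, b == k.+1 & j' <= c].
  rewrite /violated; case: ltnP => [/(X _ _ _ ab)//|/=].
  by case: eqVneq => //= _; case: eqVneq => //= ->; lia.
by rewrite /flipped !V; case: (a == k); case: (b == k.+1) => //=; lia.
Qed.

(* A row strictly between the two flipped rows would have to be both above and
   below them in value, so the flipped rows are adjacent. *)
Lemma flipped_crossed a0 b0 c : a0 < b0 ->
    (forall a b j, a < b ->
       flipped a b j = [&& a == a0, b == b0 & j == c]) ->
  crossed a0 c.
Proof.
move=> ab0 F.
have V a b j : a < b -> violated a b j = [&& a == a0, b == b0 & j <= c].
  move=> ab; case: (boolP ((a == a0) && (b == b0))) => [/andP[/eqP Ea /eqP Eb]|nab].
    subst a0 b0; rewrite !eqxx /=; case: (leqP j c) => jc; last first.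
      by apply: not_flipped_not_violated => j' jj'; rewrite F // !eqxx /=; lia.
    (* The flip at [c] makes column [c] violated; the status then propagates to the left. *)
    have [d] := ubnP (c - j); elim: d j jc => // d IH j jc Hd.
    case: (eqVneq j c) => [->|ne].
      have := F a b c ab; rewrite !eqxx /flipped.
      rewrite (@not_flipped_not_violated a b c.+1) => [|j' jj'].
        by case: violated.
      by rewrite F // !eqxx /=; lia.
    have := F a b j ab; rewrite /flipped !eqxx (negbTE ne) /= => /negbFE/eqP ->.
    by apply: IH; lia.
  rewrite andbA (negbTE nab) /=.
  by apply: not_flipped_not_violated => j' _; rewrite F // andbA (negbTE nab).
have := V a0 b0 c ab0; rewrite !eqxx leqnn /violated => /andP[cM lt].
have eb : b0 = a0.+1.
  case: (ltngtP b0 a0.+1) => // [|mid]; first lia.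
  have cd : c < M a0.+1 by have := @part_mu a0.+1 b0; lia.
  have := V a0 a0.+1 c (ltnSn _); have := V a0.+1 b0 c mid.
  rewrite /violated cM cd /=; lia.
subst b0; split=> // a b j ab jb.
by have := V a b j ab; rewrite /violated jb.
Qed.

End Tableau.

(** * From inversions of tableaux to flips *)

Section Boxes.

Variable mu : seq nat.
Local Notation M i := (nth 0 mu i).
Local Notation N := (sumn mu).
Implicit Types (b c : box mu) (t : filling mu).

Lemma col_ltn b : col b < M (row b).
Proof. exact: ltn_ord. Qed.

Lemma box_exists i j : j < M i -> exists b : box mu, row b = i /\ col b = j.
Proof.
move=> jM; have im : i < size mu.
  by case: (ltnP i (size mu)) => // H; rewrite nth_default in jM.
by exists (existT (fun i : 'I_(size mu) => 'I_(M i)) (Ordinal im) (Ordinal jM)).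
Qed.

Lemma box_eq b c : row b = row c -> col b = col c -> b = c.
Proof.
case: b c => [i x] [j y]; rewrite /row /col /= => /val_inj E.
by subst j => /val_inj ->.
Qed.

Definition entry t (i j : nat) : nat :=
  if [pick b | (row b == i) && (col b == j)] is Some b then t b else 0.

Definition row_of t (k : nat) : nat :=
  if [pick b | t b == k :> nat] is Some b then row b else 0.

Definition word t : seq nat := prefix_word (row_of t) N.

Lemma entry_box t b : entry t (row b) (col b) = t b.
Proof.
rewrite /entry; case: pickP => [c /andP[/eqP rE /eqP cE]|/(_ b)].
  by rewrite (box_eq rE cE).
by rewrite !eqxx.
Qed.

Lemma entry_ltn t i j : j < M i -> entry t i j < N.
Proof. by move=> /box_exists[b [<- <-]]; rewrite entry_box. Qed.

Lemma row_standardP t : row_standard t ->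
  forall i j j', j < j' -> j' < M i -> entry t i j < entry t i j'.
Proof.
move=> /forallP rs i j j' jj' jM.
have [b [rb cb]] := box_exists (ltn_trans jj' jM).
have [c [rc cc]] := box_exists jM.
have /forallP /(_ c) := rs b.
by rewrite rb rc cb cc eqxx jj' /= -!entry_box rb rc cb cc.
Qed.

Lemma row_of_box t b : is_tableau t -> row_of t (t b) = row b.
Proof.
move=> /andP[/injectiveP tI _]; rewrite /row_of.
by case: pickP => [c /eqP/val_inj/tI ->|/(_ b)]; rewrite ?eqxx.
Qed.

Lemma row_of_entry t : is_tableau t ->
  forall i j, j < M i -> row_of t (entry t i j) = i.
Proof. by move=> tt i j /box_exists[b [<- <-]]; rewrite entry_box row_of_box. Qed.

Lemma entry_row_of t : is_tableau t ->
  forall k, k < N -> exists2 j, j < M (row_of t k) & entry t (row_of t k) j = k.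
Proof.
move=> tt k kN; have /andP[_ /forallP /(_ (Ordinal kN)) /codomP[b Eb]] := tt.
have E : k = t b by rewrite -Eb.
by rewrite {}E row_of_box //; exists (col b); rewrite ?col_ltn ?entry_box.
Qed.

Lemma row_of_ltn t k m : size mu <= m -> 0 < N -> row_of t k < m.
Proof.
move=> sm N0; rewrite /row_of; case: pickP => [b _|_].
  exact: leq_trans (ltn_ord _) sm.
by case: mu sm N0 => //= *; lia.
Qed.

Lemma has_rightE b : has_right b = ((col b).+1 < M (row b)).
Proof.
apply/existsP/idP => [[c /andP[/eqP rE /eqP cE]]|/box_exists[c [rE cE]]].
  by rewrite -cE -rE col_ltn.
by exists c; rewrite /right_of rE cE !eqxx.
Qed.

Lemma inversionE t b c :
  inversion t b c =
  [&& col b == col c, t b < t c &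
      (~~ ((col b).+1 < M (row b)) || ~~ ((col c).+1 < M (row c)))
        && (row c < row b)
      || [&& (col b).+1 < M (row b), (col c).+1 < M (row c) &
             entry t (row c) (col c).+1 < entry t (row b) (col b).+1]].
Proof.
rewrite /inversion !has_rightE; congr [&& _, _ & _ || _].
apply/existsP/idP => [[b' /existsP[c']]|].
  case/and3P=> /andP[/eqP rb /eqP cb] /andP[/eqP rc /eqP cc].
  by rewrite -cb -rb -cc -rc !entry_box !col_ltn.
case/and3P=> /box_exists[b' [rb cb]] /box_exists[c' [rc cc]] H.
exists b'; apply/existsP; exists c'; rewrite /right_of rb cb rc cc !eqxx /=.
by rewrite -!entry_box rb cb rc cc.
Qed.

Hypothesis part_mu : forall a b : nat, a <= b -> M b <= M a.

(** Both orders appear because [inversion] takes the box with the smaller entry first. *)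
Lemma inversion_flipped t b c : is_tableau t ->
    row b < row c -> col b = col c ->
  inversion t b c || inversion t c b
  = flipped mu (entry t) (row b) (row c) (col b).
Proof.
move=> tt bc cE; have Mbc := part_mu (ltnW bc).
have cM := col_ltn c.
rewrite !inversionE /flipped /violated !cE eqxx cM /= -!entry_box cE.
have ne j : j < M (row c) -> entry t (row b) j != entry t (row c) j.
  move=> jc; apply/eqP => E; have jb : j < M (row b) by lia.
  by have := row_of_entry tt jb; rewrite E row_of_entry //; lia.
have := ne _ cM.
case: (ltnP (col c).+1 (M (row c))) => [lt|ge]; last by lia.
have -> : (col c).+1 < M (row b) by lia.
by have := ne _ lt; rewrite /=; lia.
Qed.

Lemma inversion_rows t b c : inversion t b c ->
  col b = col c /\ (row b < row c \/ row c < row b).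
Proof.
move=> /and3P[/eqP cE lt _]; split=> //.
case: (ltngtP (row b) (row c)) => [||rE]; [by left | by right |].
by rewrite (box_eq rE cE) ltnn in lt.
Qed.

Lemma flipped_inversion t (a b j : nat) : is_tableau t -> a < b ->
    flipped mu (entry t) a b j ->
  exists b1 b2 : box mu, [/\ row b1 = a, row b2 = b, col b1 = j, col b2 = j
    & inversion t b1 b2 || inversion t b2 b1].
Proof.
move=> tt ab F; have jb : j < M b.
  by move: F; rewrite /flipped /violated; case: ltnP => //=; lia.
have ja : j < M a by have := part_mu (ltnW ab); lia.
have [b1 [rb1 cb1]] := box_exists ja; have [b2 [rb2 cb2]] := box_exists jb.
exists b1, b2; split=> //.
by rewrite inversion_flipped ?rb1 ?rb2 ?cb1 ?cb2.
Qed.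

Lemma ninv0P t : is_tableau t ->
  reflect (forall a b j : nat, a < b -> ~~ flipped mu (entry t) a b j) (ninv t == 0).
Proof.
move=> tt; rewrite /ninv cards_eq0.
apply: (iffP eqP) => [/setP E a b j ab|H].
  apply/negP => /(flipped_inversion tt ab)[b1 [b2 [_ _ _ _]]].
  by have := E (b1, b2); have := E (b2, b1); rewrite !inE /= => -> ->.
apply/setP => -[b c]; rewrite !inE /=; apply/negP => I.
have [cE [lt|lt]] := inversion_rows I.
  by have := H _ _ (col b) lt; rewrite -inversion_flipped // I.
by have := H _ _ (col c) lt; rewrite -inversion_flipped // I orbT.
Qed.

Lemma ninv1P t : is_tableau t ->
  reflect (exists k c : nat, crossed mu (entry t) k c) (ninv t == 1).
Proof.
move=> tt; have Iasym b c : inversion t b c -> inversion t c b = false.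
  by move=> /and3P[_ lt _]; rewrite /inversion ltnNge (ltnW lt) andbF.
apply: (iffP cards1P) => [[[b0 c0] /setP E]|[k [c X]]].
  have inv b c : inversion t b c = (b == b0) && (c == c0).
    by have := E (b, c); rewrite !inE.
  have I0 : inversion t b0 c0 by rewrite inv !eqxx.
  have [cE0 lt0] := inversion_rows I0.
  (* The two boxes are renamed so that [b1] is the upper one, whichever holds the smaller entry. *)
  wlog [b1 [c1 [lt1 cE1 {}inv]]] : / exists b1 c1 : box mu,
      [/\ row b1 < row c1, col b1 = col c1 &
      forall b c, row b < row c ->
        inversion t b c || inversion t c b = (b == b1) && (c == c1)].
    apply; case: lt0 => lt.
      exists b0, c0; split=> // b c bc; rewrite !inv.
      case: (eqVneq c b0) => [E1|]; rewrite ?orbF //.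
      by case: (eqVneq b c0) => [E2|]; rewrite ?orbF //; subst b c; lia.
    exists c0, b0; split=> // b c bc; rewrite !inv orbC andbC.
    case: (eqVneq b b0) => [E1|]; rewrite ?orbF //.
    by case: (eqVneq c c0) => [E2|]; rewrite ?orbF //; subst b c; lia.
  exists (row b1), (col b1); apply: (flipped_crossed part_mu lt1).
  move=> a b j ab; apply/idP/and3P => [F|[/eqP-> /eqP-> /eqP->]].
    have [d1 [d2 [r1 r2 e1 e2]]] := flipped_inversion tt ab F.
    rewrite inv ?r1 ?r2 // => /andP[/eqP E1 /eqP E2].
    by rewrite -r1 -r2 -e1 E1 E2 !eqxx.
  by rewrite -inversion_flipped // inv // !eqxx.
have F := crossed_flipped X.
have : flipped mu (entry t) k k.+1 c by rewrite F // !eqxx.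
case/(flipped_inversion tt (ltnSn k)) => b1 [b2 [r1 r2 e1 e2 I]].
(* The unique flip fixes the two boxes up to order; asymmetry of [inversion] settles the order. *)
have uniq b c' : inversion t b c' ->
    (b = b1 /\ c' = b2) \/ (b = b2 /\ c' = b1).
  move=> J; have [cE [lt|lt]] := inversion_rows J.
    have := inversion_flipped tt lt cE; rewrite J /= F // => /esym/and3P.
    move=> [/eqP Eb /eqP Ec /eqP Ej]; left.
    by split; apply: box_eq; rewrite -?cE ?r1 ?r2 ?e1 ?e2.
  have := inversion_flipped tt lt (esym cE); rewrite J orbT /= F // => /esym/and3P.
  move=> [/eqP Eb /eqP Ec /eqP Ej]; right.
  by split; apply: box_eq; rewrite ?cE ?r1 ?r2 ?e1 ?e2.
case/orP: I => I; [exists (b1, b2) | exists (b2, b1)]; apply/setP => -[b c'];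
  rewrite !inE /= xpair_eqE; apply/idP/andP => [J|[/eqP-> /eqP->]] //;
  have [[Eb Ec]|[Eb Ec]] := uniq _ _ J; subst b c'; rewrite ?eqxx //;
  by rewrite Iasym in J.
Qed.

End Boxes.

(** * Bijection between row-standard tableaux and words *)

Definition shape_content (mu : seq nat) (i : nat) : int := (nth 0 mu i)%:Z.

Lemma size_prefix_word r q : size (prefix_word r q) = q.
Proof. by elim: q => //= q ->. Qed.

Lemma nth_rev_prefix_word r q k :
  k < q -> nth 0 (rev (prefix_word r q)) k = r k.
Proof.
elim: q => // q IH kq; rewrite /= rev_cons nth_rcons size_rev size_prefix_word.
move: kq; rewrite ltnS leq_eqVlt => /predU1P[->|kq]; last by rewrite kq IH.
by rewrite ltnn eqxx.
Qed.

Lemma eq_prefix_word r r' q :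
  (forall k, k < q -> r k = r' k) -> prefix_word r q = prefix_word r' q.
Proof.
by elim: q => //= q IH H; rewrite H // IH // => k kq; apply: H; lia.
Qed.

Lemma prefix_word_nth_rev w : prefix_word (nth 0 (rev w)) (size w) = w.
Proof.
elim: w => //= a w IH; rewrite rev_cons nth_rcons size_rev ltnn eqxx.
congr (_ :: _); rewrite -[RHS]IH; apply: eq_prefix_word => k kw.
by rewrite nth_rcons size_rev kw.
Qed.

Section CountTableaux.

Variables (mu : seq nat) (m : nat).
Local Notation M i := (nth 0 mu i).
Local Notation N := (sumn mu).
Hypothesis size_mu : size mu <= m.

Lemma word_in_words (t : filling mu) : word t \in words m N.
Proof.
rewrite mem_words size_prefix_word eqxx /=.
have : forall k, 0 < N -> row_of t k < m by move=> k; apply: row_of_ltn.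
rewrite /word; elim: N => //= q IH H; rewrite H //= IH //.
by move=> k _; apply: H.
Qed.

Lemma content_word (t : filling mu) : is_tableau t -> row_standard t ->
  eq_upto m (content (word t)) (shape_content mu).
Proof.
move=> tt rs; apply/eq_uptoP => i im; congr Posz.
rewrite /word (count_prefix_word (row_standardP rs) (row_of_entry tt)
  (entry_row_of tt)) //.
have -> : count (fun j => entry t i j < N) (iota 0 (M i))
        = count predT (iota 0 (M i)).
  by apply: eq_in_count => j; rewrite mem_iota => jM; rewrite entry_ltn.
by rewrite count_predT size_iota.
Qed.

(** The word tells, for each [q], which boxes hold entries below [q]. Taking [q] one more than
    either entry of a box gives both inequalities. *)
Lemma word_inj (t t' : filling mu) :
    is_tableau t -> row_standard t -> is_tableau t' -> row_standard t' ->
  word t = word t' -> t = t'.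
Proof.
move=> tt rs tt' rs' E.
have rE k : k < N -> row_of t k = row_of t' k.
  by move=> kN; rewrite -(nth_rev_prefix_word (row_of t) kN) -/(word t) E
    nth_rev_prefix_word.
have lt i j q : q <= N -> j < M i ->
    (entry t i j < q) = (entry t' i j < q).
  move=> qN jM.
  have := ltn_count_prefix_word (row_standardP rs) (row_of_entry tt)
    (entry_row_of tt) i j qN.
  rewrite jM (eq_prefix_word (r' := row_of t')); last by move=> k kq; apply: rE; lia.
  by rewrite (ltn_count_prefix_word (row_standardP rs') (row_of_entry tt')
    (entry_row_of tt')) // jM /= => ->.
apply/ffunP => b; apply/val_inj; rewrite /= -!entry_box.
have bM := col_ltn b.
have := lt _ _ _ (entry_ltn t bM) bM; have := lt _ _ _ (entry_ltn t' bM) bM.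
lia.
Qed.

(** Row [i] receives, in increasing order, the times at which the letter [i] is read. *)
Lemma word_surj w : w \in words m N ->
    eq_upto m (content w) (shape_content mu) ->
  exists t : filling mu, [/\ is_tableau t, row_standard t & word t = w].
Proof.
rewrite mem_words => /andP[/eqP sw /allP wm] /eq_uptoP cw.
pose u := rev w; pose r k := nth 0 u k.
pose pos i := [seq k <- iota 0 N | r k == i].
have uE : u = [seq r k | k <- iota 0 N].
  by rewrite -sw -(size_rev w) map_nth_iota0 // take_size.
have size_pos i : i < m -> size (pos i) = M i.
  move=> im; rewrite size_filter; have [<-] := cw i im.
  by rewrite -[RHS]count_rev -/u uE count_map.
have posP i k : (k \in pos i) = (r k == i) && (k < N).
  by rewrite mem_filter mem_iota.
have row_m (b : box mu) : row b < m by apply: leq_trans (ltn_ord _) size_mu.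
have posb (b : box mu) : nth 0 (pos (row b)) (col b) \in pos (row b).
  by apply: mem_nth; rewrite size_pos // col_ltn.
have ltN (b : box mu) : nth 0 (pos (row b)) (col b) < N.
  by have := posb b; rewrite posP => /andP[].
pose t : filling mu := [ffun b => Ordinal (ltN b)].
have tE b : t b = nth 0 (pos (row b)) (col b) :> nat by rewrite ffunE.
have rt b : r (t b) = row b.
  by have := posb b; rewrite posP tE => /andP[/eqP].
have rm k : k < N -> r k < m.
  by move=> kN; apply: wm; rewrite -mem_rev mem_nth // size_rev sw.
have tt : is_tableau t.
  apply/andP; split.
    apply/injectiveP => b c E.
    have rE : row b = row c by rewrite -!rt E.
    apply: box_eq => //; apply/eqP.
    rewrite -(nth_uniq 0 (s := pos (row b))) ?filter_uniq ?iota_uniq //.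
    - by rewrite -tE E tE rE.
    - by rewrite size_pos // col_ltn.
    - by rewrite size_pos // rE col_ltn.
  apply/forallP => k; have kN := ltn_ord k.
  have kp : val k \in pos (r k) by rewrite posP eqxx.
  have := kp; rewrite -index_mem size_pos ?rm // => /box_exists[b [rb cb]].
  apply/codomP; exists b; apply/val_inj.
  by rewrite /= tE rb cb nth_index.
have rs : row_standard t.
  apply/forallP => b; apply/forallP => c; apply/implyP => /andP[/eqP rE lt].
  rewrite !tE rE; apply: (sorted_ltn_nth ltn_trans) => //.
  - exact/sorted_filter/iota_ltn_sorted/ltn_trans.
  - by rewrite inE size_pos // -rE col_ltn.
  - by rewrite inE size_pos // col_ltn.
exists t; split=> //; rewrite /word -[RHS]prefix_word_nth_rev sw.
apply: eq_prefix_word => k kN.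
have /andP[_ /forallP /(_ (Ordinal kN)) /codomP[b Eb]] := tt.
have E : k = t b by rewrite -Eb.
by rewrite E row_of_box // -rt.
Qed.

Lemma card_S_count i (P : pred (seq nat)) :
    (forall t : filling mu, is_tableau t -> row_standard t ->
       (ninv t == i) = P (word t)) ->
  #|S_ i mu|
  = count (fun w => P w && eq_upto m (content w) (shape_content mu)) (words m N).
Proof.
move=> H; rewrite cardE -(size_map (@word mu)) -size_filter.
apply: perm_size; apply: uniq_perm.
- rewrite map_inj_in_uniq ?enum_uniq // => t t'.
  rewrite !mem_enum !inE => /and3P[tt rs _] /and3P[tt' rs' _].
  exact: word_inj.
- exact/filter_uniq/uniq_words.
move=> w; rewrite mem_filter; apply/mapP/andP => [[t]|[/andP[Pw cw] ww]].
  rewrite mem_enum inE => /and3P[tt rs Pt] ->.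
  by rewrite -H // Pt content_word // word_in_words.
have [t [tt rs wt]] := word_surj ww cw.
by exists t => //; rewrite mem_enum inE tt rs H // wt Pw.
Qed.

Hypothesis part_mu : forall a b, a <= b -> M b <= M a.

Lemma card_S0 : #|S_ 0 mu| = nballot m N (shape_content mu).
Proof.
apply: card_S_count => t tt rs.
have B := ballot_word_standard part_mu (row_standardP rs) (@entry_ltn _ t)
  (row_of_entry tt) (entry_row_of tt) size_mu.
have E := standard_not_flipped part_mu (row_of_entry tt).
by apply/(ninv0P part_mu tt)/B => [/E|/E].
Qed.

Lemma card_S1 : #|S_ 1 mu| = ncrossing m N (shape_content mu).
Proof.
apply: card_S_count => t tt rs.
apply/(ninv1P part_mu tt)/idP => [[k [c X]]|].
  exact: (crossed_once_crossing part_mu (row_standardP rs) (@entry_ltn _ t)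
    (row_of_entry tt) (entry_row_of tt) size_mu X).
exact: (once_crossing_crossed part_mu (row_standardP rs) (@entry_ltn _ t)
    (row_of_entry tt) (entry_row_of tt) size_mu).
Qed.

End CountTableaux.

(** * The rectangle and the modified shape *)

Lemma nth_omit_zero_rows mu :
    (forall a b, a <= b -> nth 0 mu b <= nth 0 mu a) ->
  forall i, nth 0 (omit_zero_rows mu) i = nth 0 mu i.
Proof.
rewrite /omit_zero_rows; elim: mu => //= a mu IH H i.
have {}IH := IH (fun a b ab => H a.+1 b.+1 ab).
case: (posnP a) => [a0|a1]; last by case: i.
(* A zero row forces all later rows to be zero, which is also the default value of [nth]. *)
by rewrite IH; have := H 0 i.+1; have := H 0 i; rewrite /= a0; lia.
Qed.

Lemma sumn_omit_zero_rows mu : sumn (omit_zero_rows mu) = sumn mu.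
Proof. by elim: mu => //= a mu; case: posnP => [->|_ /= ->]. Qed.

Theorem theorem3p1 (n m : nat) (lambda_tilde : seq nat)
    (hn : 1 <= n) (hm : 1 <= m)
    (hlt : is_lambda_tilde n m lambda_tilde) :
  #|S_ 1 (nseq m n)| = #|S_ 0 (omit_zero_rows lambda_tilde)|.
Proof.
case: hlt; set lam := lambda_tilde => sz h0 hl hmid.
(* For one row, the first and last lengths would give [n.+1 = n.-1]. *)
case: m hm sz hl hmid => [|[|m]] // _ sz hl hmid; first by move: hl; rewrite /= h0; lia.
have lamE i : i < m.+2 ->
    shape_content lam i = del_box (add_box (fun=> Posz n) 0) m.+1 i.
  rewrite /shape_content /del_box /add_box => im.
  case: (posnP i) => [->|i0]; first by rewrite h0; lia.
  case: (eqVneq i m.+1) => [->|ne]; first by move: hl => /= ->; lia.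
  by rewrite hmid /=; lia.
have part_lam a b : a <= b -> nth 0 lam b <= nth 0 lam a.
  move=> ab; case: (ltnP b m.+2) => bm; last by rewrite [nth 0 lam b]nth_default ?sz.
  have := lamE a; have := lamE b; rewrite /shape_content /del_box /add_box; lia.
have part_rect a b : a <= b -> nth 0 (nseq m.+2 n) b <= nth 0 (nseq m.+2 n) a.
  by move=> ab; rewrite !nth_nseq; do 2?case: ifP; lia.
rewrite (@card_S1 _ m.+2) ?size_nseq //.
(* For [n = 1] the last row is omitted, but words over [m.+2] letters may still be used: the missing
   row has length 0. *)
rewrite (@card_S0 _ m.+2); last first.
- by move=> a b ab; rewrite !nth_omit_zero_rows // part_lam.
- by rewrite -sz size_filter count_size.
have -> : sumn (omit_zero_rows lam) = sumn (nseq m.+2 n).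
  rewrite sumn_omit_zero_rows sumn_nseq (sumnE) (big_nth 0) sz big_mkord.
  rewrite big_ord_recl big_ord_recr /= h0.
  rewrite (eq_bigr (fun=> n)) => [|i _]; last by rewrite hmid /= /bump; have := ltn_ord i; lia.
  rewrite sum_nat_const card_ord; move: hl => /= ->; lia.
rewrite ncrossing_nraised; last first.
  by apply/domP => i im; have := part_rect i i.+1; rewrite /shape_content; lia.
(* The rectangle's content is constant only on its [m.+2] rows, which is all that the count looks
   at. *)
have E : nraised m.+2 (sumn (nseq m.+2 n)) (shape_content (nseq m.+2 n))
       = nraised m.+2 (sumn (nseq m.+2 n)) (fun=> Posz n).
  apply: eq_bigr => i _; apply: eq_bigr => j _; apply: eq_nballot => p pm.
  by rewrite /del_box /add_box /shape_content nth_nseq pm.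
rewrite E nraised_rectangle; apply: eq_nballot => i im.
by rewrite -lamE // /shape_content nth_omit_zero_rows.
Qed.
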